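(* If a causal manifold $(M,\gamma)$ admits a Cauchy time function, then its cc-preorder is proper.
   Context: Manifolds are real $C^\infty$-manifolds and morphisms of manifolds are $C^\infty$ maps. A cone in a vector bundle is a subset invariant under multiplication by $\mathbb{R}_{>0}$ in the fibres; it is convex if each fibre is convex. A causal manifold $(M,\gamma)$ is a nonempty connected manifold $M$ with an open convex cone $\gamma\subset TM$ such that $\gamma_x\neq\varnothing$ for all $x\in M$. A morphism of causal manifolds $f:(M,\gamma_M)\to(N,\gamma_N)$ is a $C^\infty$ map with $Tf(\overline{\gamma_M})\subset\overline{\gamma_N}$. $(\mathbb{R},+)$ is $\mathbb{R}$ with the cone $\{(t;v)\in T\mathbb{R}:v>0\}$. For $A,B\subset M$, the Whitney cone $C(A,B)\subset TM$ is described in a chart at $x_0$ by: $v\in C_{x_0}(A,B)$ iff there are $(x_n,y_n,c_n)\in A\times B\times\mathbb{R}_{>0}$ with $x_n,y_n\to x_0$, $c_n(x_n-y_n)\to v$. Set $N(A)=TM\setminus C(M\setminus A,A)$; $A$ is a $\gamma$-set if $\gamma\subset N(A)$. With $\gamma^a=\{(x;-v):(x;v)\in\gamma\}$, a preorder $\preceq$ on $M$ with graph $\Delta_\preceq\subset M\times M$ is closed if $\Delta_\preceq$ is closed, and causal if $\Delta_\preceq$ is a $(\gamma^a\times\gamma)$-set of $M\times M$. The cc-preorder $\preceq_{\rm cc}$ is the preorder whose graph is the intersection of the graphs of all closed causal preorders. For a preorder $\preceq$, $J^-_\preceq(A)=\{x:\exists y\in A,\ x\preceq y\}$, $J^+_\preceq(A)=\{x:\exists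 y\in A,\ y\preceq x\}$ (written $J^\pm_{\rm cc}$ for the cc-preorder). A preorder $\preceq$ is proper if $J^+_\preceq(A)\cap J^-_\preceq(B)$ is compact for any two compact subsets $A,B\subset M$. A Cauchy time function on $(M,\gamma)$ is a submersive morphism of causal manifolds $q:(M,\gamma)\to(\mathbb{R},+)$ which is proper on the sets $J^+_{\rm cc}(K)$ and $J^-_{\rm cc}(K)$ for any compact $K\subset M$. *)

(* Defs.v *)
From HB Require Import structures.
From mathcomp Require Import all_boot all_order all_algebra.
From mathcomp Require Import all_classical all_reals all_analysis.

Set Implicit Arguments.
Unset Strict Implicit.
Unset Printing Implicit Defensive.

Import Order.TTheory GRing.Theory Num.Theory.
Import numFieldTopology.Exports numFieldNormedType.Exports.

Local Open Scope classical_set_scope.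
Local Open Scope ring_scope.

Lemma open_setX (S T : topologicalType) (A : set S) (B : set T) :
  open A -> open B -> open (A `*` B).
Proof.
rewrite !openE => oA oB [x y] [/= Ax By].
by exists (A, B) => //=; split; [exact: oA | exact: oB].
Qed.

(* For finite-dimensional [E] and open [U]: [f] is C^(k+1) on [U] iff it is
   differentiable there and [x |-> 'd f x v] is C^k for every [v]. *)
Fixpoint Ck_on (R : realType) (E F : normedModType R) (k : nat) (U : set E)
    (f : E -> F) : Prop :=
  if k is k'.+1 then
    (forall x, U x -> differentiable f x) /\
    (forall v, Ck_on k' U (fun x => 'D_v f x))
  else forall x, U x -> {for x, continuous f}.

Definition smooth_on (R : realType) (E F : normedModType R) (U : set E)
    (f : E -> F) : Prop := forall k, Ck_on k U f.

(* A homeomorphism from an open subset of [T] onto an open subset of [E]. The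
   values of [chart_fun] and [chart_inv] outside these subsets are junk. *)
Record chart (R : realType) (E : normedModType R) (T : topologicalType) :=
  Chart {
    chart_dom : set T;
    chart_cod : set E;
    chart_fun : T -> E;
    chart_inv : E -> T;
    chart_dom_open : open chart_dom;
    chart_cod_open : open chart_cod;
    chart_funS : forall x, chart_dom x -> chart_cod (chart_fun x);
    chart_invS : forall y, chart_cod y -> chart_dom (chart_inv y);
    chart_funK : forall x, chart_dom x -> chart_inv (chart_fun x) = x;
    chart_invK : forall y, chart_cod y -> chart_fun (chart_inv y) = y;
    chart_fun_continuous :
      forall x, chart_dom x -> {for x, continuous chart_fun};
    chart_inv_continuous :
      forall y, chart_cod y -> {for y, continuous chart_inv} }.

(* [chart_at x] is a preferred chart at [x]; it serves to identify the tangent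
   space at [x] with [E]. *)
Record charted_space (R : realType) (E : normedModType R) := ChartedSpace {
  charted_sort :> topologicalType;
  atlas : set (chart E charted_sort);
  chart_at : charted_sort -> chart E charted_sort;
  chart_at_atlas : forall x, atlas (chart_at x);
  chart_at_dom : forall x, chart_dom (chart_at x) x }.

Definition smooth_manifold (R : realType) (E : normedModType R)
    (M : charted_space E) : Prop :=
  [/\ hausdorff_space M,
      @second_countable M &
      forall c d, @atlas R E M c -> @atlas R E M d ->
        smooth_on (chart_cod c `&` chart_inv c @^-1` chart_dom d)
                  (chart_fun d \o chart_inv c)].

Definition smooth_map (R : realType) (E F : normedModType R)
    (M : charted_space E) (N : charted_space F) (f : M -> N) : Prop :=
  continuous f /\
  forall c d, @atlas R E M c -> @atlas R F N d ->
    smooth_on (chart_cod c `&` (f \o chart_inv c) @^-1` chart_dom d)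
              (chart_fun d \o f \o chart_inv c).

(* [TangentVector x v] is the tangent vector at [x] whose coordinates in the
   chart [chart_at x] are [v]. *)
Record tangent_bundle (R : realType) (E : normedModType R)
    (M : charted_space E) := TangentVector {
  tbase : M;
  tvec : E }.

(* The tangent vector at [chart_inv c p.1] with coordinates [p.2] in [c]. *)
Definition tangent_of_chart (R : realType) (E : normedModType R)
    (M : charted_space E) (c : chart E M) (p : E * E) : tangent_bundle M :=
  let x := chart_inv c p.1 in
  TangentVector x ('d (chart_fun (chart_at x) \o chart_inv c) (p.1) p.2).

Section tangent_topology.
Context (R : realType) (E : normedModType R) (M : charted_space E).
Local Notation TM := (tangent_bundle M).

HB.instance Definition _ := gen_eqMixin TM.
HB.instance Definition _ := gen_choiceMixin TM.

Definition tangent_open : set (set TM) :=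
  [set A | forall c, @atlas R E M c ->
    open [set p : E * E | chart_cod c p.1 /\ A (tangent_of_chart c p)]].

Let tangent_openT : tangent_open setT.
Proof.
move=> c _.
rewrite [X in open X](_ : _ = chart_cod c `*` setT).
  by apply: open_setX; [exact: chart_cod_open | exact: openT].
by [].
Qed.

Let tangent_openI : setI_closed tangent_open.
Proof.
move=> A B oA oB c cM.
rewrite [X in open X](_ : _ =
  [set p : E * E | chart_cod c p.1 /\ A (tangent_of_chart c p)] `&`
  [set p : E * E | chart_cod c p.1 /\ B (tangent_of_chart c p)]).
  by apply: openI; [exact: oA | exact: oB].
by apply/seteqP; split=> p /= => [[cp [Ap Bp]]|[[cp Ap] [_ Bp]]].
Qed.

Let tangent_open_bigU (I : Type) (f : I -> set TM) :
  (forall i, tangent_open (f i)) -> tangent_open (\bigcup_i f i).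
Proof.
move=> of_ c cM.
rewrite [X in open X](_ : _ = \bigcup_i
  [set p : E * E | chart_cod c p.1 /\ f i (tangent_of_chart c p)]).
  by apply: bigcup_open => i _; exact: of_.
by apply/seteqP; split=> p /= => [[cp [i _ fp]]|[i _ [cp fp]]];
  [exists i | split=> //; exists i].
Qed.

HB.instance Definition _ := isOpenTopological.Build TM
  tangent_openT tangent_openI tangent_open_bigU.

End tangent_topology.

Definition tangent_map (R : realType) (E F : normedModType R)
    (M : charted_space E) (N : charted_space F) (f : M -> N)
    (p : tangent_bundle M) : tangent_bundle N :=
  let c := chart_at (tbase p) in
  let d := chart_at (f (tbase p)) in
  TangentVector (f (tbase p))
    ('d (chart_fun d \o f \o chart_inv c) (chart_fun c (tbase p)) (tvec p)).

Definition submersive (R : realType) (E F : normedModType R)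
    (M : charted_space E) (N : charted_space F) (f : M -> N) : Prop :=
  forall (x : M) (w : F), exists v : E,
    tangent_map f (TangentVector x v) = TangentVector (f x) w.

Section product.
Context (R : realType) (E F : normedModType R).

Section product_chart.
Context (S T : topologicalType) (c : chart E S) (d : chart F T).

Let f (p : S * T) : E * F := (chart_fun c p.1, chart_fun d p.2).
Let g (q : E * F) : S * T := (chart_inv c q.1, chart_inv d q.2).
Let D := chart_dom c `*` chart_dom d.
Let C := chart_cod c `*` chart_cod d.

Let D_open : open D.
Proof. by apply: open_setX; exact: chart_dom_open. Qed.

Let C_open : open C.
Proof. by apply: open_setX; exact: chart_cod_open. Qed.

Let fS p : D p -> C (f p).
Proof. by case=> ? ?; split; exact: chart_funS. Qed.

Let gS q : C q -> D (g q).
Proof. by case=> ? ?; split; exact: chart_invS. Qed.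

Let fK p : D p -> g (f p) = p.
Proof. by case: p => x y [? ?]; rewrite /g /f /= !chart_funK. Qed.

Let gK q : C q -> f (g q) = q.
Proof. by case: q => x y [? ?]; rewrite /g /f /= !chart_invK. Qed.

Let f_continuous p : D p -> {for p, continuous f}.
Proof.
move=> [? ?]; apply: cvg_pair.
  by apply: continuous_comp; [exact: cvg_fst | exact: chart_fun_continuous].
by apply: continuous_comp; [exact: cvg_snd | exact: chart_fun_continuous].
Qed.

Let g_continuous q : C q -> {for q, continuous g}.
Proof.
move=> [? ?]; apply: cvg_pair.
  by apply: continuous_comp; [exact: cvg_fst | exact: chart_inv_continuous].
by apply: continuous_comp; [exact: cvg_snd | exact: chart_inv_continuous].
Qed.

Definition prod_chart : chart (E * F)%type (S * T)%type :=
  Chart D_open C_open fS gS fK gK f_continuous g_continuous.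

End product_chart.

Context (M : charted_space E) (N : charted_space F).

Let A : set (chart (E * F)%type (M * N)%type) :=
  [set e | exists c d, [/\ @atlas R E M c, @atlas R F N d &
                           e = prod_chart c d]].

Let a (p : M * N) := prod_chart (chart_at p.1) (chart_at p.2).

Let a_atlas p : A (a p).
Proof.
by exists (chart_at p.1), (chart_at p.2); split=> //; exact: chart_at_atlas.
Qed.

Let a_dom p : chart_dom (a p) p.
Proof. by split; exact: chart_at_dom. Qed.

Definition prod_charted : charted_space (E * F)%type :=
  ChartedSpace a_atlas a_dom.

End product.

Section real_line.
Context (R : realType).

Definition id_chart : chart R^o R :=
  @Chart R R^o R setT setT id id openT openT
    (fun _ _ => I) (fun _ _ => I) (fun _ _ => erefl) (fun _ _ => erefl)
    (fun _ _ => cvg_id) (fun _ _ => cvg_id).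

Definition real_line : charted_space R^o :=
  @ChartedSpace R R^o R [set id_chart] (fun _ => id_chart)
    (fun _ => erefl) (fun _ => I).

Definition real_line_cone : set (tangent_bundle real_line) :=
  [set p : tangent_bundle real_line | 0 < (tvec p : R)].

End real_line.

Section causal.
Context (R : realType) (E : normedModType R) (M : charted_space E).
Implicit Types g : set (tangent_bundle M).

Definition is_cone g : Prop :=
  forall (x : M) (v : E) (t : R), 0 < t ->
    g (TangentVector x v) -> g (TangentVector x (t *: v)).

Definition fibrewise_convex g : Prop :=
  forall x : M,
    convex_set [set v : convex_lmodType E | g (TangentVector x v)].

Definition causal_manifold g : Prop :=
  [/\ smooth_manifold M, [set: M] !=set0 & connected [set: M]] /\
  [/\ open g, is_cone g, fibrewise_convex g &
      forall x : M, exists v : E, g (TangentVector x v)].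

(* The coordinates are taken in the chart [chart_at] of the base point. *)
Definition whitney_cone (A B : set M) : set (tangent_bundle M) :=
  [set p | exists (x_ y_ : nat -> M) (c_ : nat -> R),
    [/\ forall n, A (x_ n), forall n, B (y_ n) & forall n, 0 < c_ n] /\
    [/\ x_ @ \oo --> tbase p, y_ @ \oo --> tbase p &
        (fun n => c_ n *: (chart_fun (chart_at (tbase p)) (x_ n) -
                           chart_fun (chart_at (tbase p)) (y_ n)))
          @ \oo --> tvec p]].

Definition strict_normal_cone (A : set M) : set (tangent_bundle M) :=
  ~` whitney_cone (~` A) A.

Definition cone_set g (A : set M) : Prop := g `<=` strict_normal_cone A.

Definition antipodal g : set (tangent_bundle M) :=
  [set p | g (TangentVector (tbase p) (- tvec p))].

End causal.

(* [T (M x N)] is [TM x TN], since the preferred charts of [prod_charted M N]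
   are products of preferred charts. *)
Definition prod_cone (R : realType) (E F : normedModType R)
    (M : charted_space E) (N : charted_space F)
    (g : set (tangent_bundle M)) (h : set (tangent_bundle N)) :
    set (tangent_bundle (prod_charted M N)) :=
  [set p : tangent_bundle (prod_charted M N) |
           g (TangentVector (tbase p).1 (tvec p).1) /\
           h (TangentVector (tbase p).2 (tvec p).2)].

Definition causal_morphism (R : realType) (E F : normedModType R)
    (M : charted_space E) (N : charted_space F)
    (g : set (tangent_bundle M)) (h : set (tangent_bundle N))
    (f : M -> N) : Prop :=
  smooth_map f /\ tangent_map f @` closure g `<=` closure h.

Record preorder (T : Type) := Preorder {
  preorder_rel :> T -> T -> Prop;
  preorder_refl : forall x, preorder_rel x x;
  preorder_trans : forall y x z,
    preorder_rel x y -> preorder_rel y z -> preorder_rel x z }.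

Definition graph (T : Type) (P : preorder T) : set (T * T) :=
  [set p | P p.1 p.2].

Definition past (T : Type) (P : preorder T) (A : set T) : set T :=
  [set x | exists2 y, A y & P x y].

Definition future (T : Type) (P : preorder T) (A : set T) : set T :=
  [set x | exists2 y, A y & P y x].

Definition closed_preorder (T : topologicalType) (P : preorder T) : Prop :=
  closed (graph P).

Definition proper_preorder (T : topologicalType) (P : preorder T) : Prop :=
  forall A B : set T, compact A -> compact B ->
    compact (future P A `&` past P B).

Definition proper_on (S T : topologicalType) (f : S -> T) (A : set S) : Prop :=
  forall C : set T, compact C -> compact (A `&` f @^-1` C).

Section cc_preorder.
Context (R : realType) (E : normedModType R) (M : charted_space E).
Variable g : set (tangent_bundle M).

Definition causal_preorder (P : preorder M) : Prop :=
  @cone_set _ _ (prod_charted M M) (prod_cone (antipodal g) g) (graph P).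

Let cc (x y : M) : Prop :=
  forall P : preorder M, closed_preorder P -> causal_preorder P -> P x y.

Let cc_refl x : cc x x.
Proof. by move=> P _ _; exact: preorder_refl. Qed.

Let cc_trans y x z : cc x y -> cc y z -> cc x z.
Proof.
move=> xy yz P Pcl Pca.
exact: preorder_trans (xy P Pcl Pca) (yz P Pcl Pca).
Qed.

Definition cc_preorder : preorder M := Preorder cc_refl cc_trans.

Definition cauchy_time_function (q : M -> real_line R) : Prop :=
  [/\ causal_morphism g (@real_line_cone R) q,
      submersive q &
      forall K : set M, compact K ->
        proper_on q (future cc_preorder K) /\
        proper_on q (past cc_preorder K)].

End cc_preorder.

(* Main.v *)
(* The relation [q x <= q y] defined by a Cauchy time function [q] is a closed
   causal preorder, so it contains the cc-preorder. If [- a <= q] on [A] and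
   [q <= b] on [B], the intersection of the future of [A] with the past of [B]
   is thus that of [J^+(A) /\ q @^-1` [- a, b]] and
   [J^-(B) /\ q @^-1` [- a, b]], which are both compact.
   For causality no strict differentiability of [q] is needed: if difference
   quotients of two sequences converge to a vector of the open cone [g], they
   eventually lie in [g] at every point of the chart segment joining the terms
   of the sequences, and [q] is nondecreasing along such a segment. *)

Require Import Defs.
From mathcomp Require Import all_boot all_order all_algebra.
From mathcomp Require Import all_classical all_reals all_analysis.
Import numFieldTopology.Exports numFieldNormedType.Exports.
Import Order.TTheory GRing.Theory Num.Theory.

Set Implicit Arguments.
Unset Strict Implicit.
Unset Printing Implicit Defensive.

Local Open Scope classical_set_scope.
Local Open Scope ring_scope.

(** Chart identities hold only on the domain of a chart, hence near a point. That suffices, since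
    the values of a differential are directional derivatives, which depend on the germ alone. *)
Lemma near_eq_diff (R : numFieldType) (V W : normedModType R) (f h : V -> W)
    (x v : V) :
  differentiable f x -> differentiable h x -> (\near x, f x = h x) ->
  'd f x v = 'd h x v.
Proof. by move=> df dh fh; rewrite -!deriveE// (near_eq_derive _ fh). Qed.

(** The mean value theorem on the unit interval, applied to the restriction [h] of [f] to the
    segment; the chain rule computes the derivative of [h]. *)
Lemma diff_ge0_le_segment (R : realType) (E : normedModType R) (f : E -> R^o)
    (a w : E) :
  (forall t : R, 0 <= t <= 1 -> differentiable f (a + t *: w)) ->
  (forall t : R, 0 <= t <= 1 -> 0 <= 'd f (a + t *: w) w) ->
  f a <= f (a + w).
Proof.
move=> df dfge0.
pose l (t : R^o) : E := a + t *: w.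
have dl (t : R^o) : is_diff t l ( *:%R^~ w).
  (* The added 0 is the differential of the constant [a], in the form the sum rule expects. *)
  by rewrite -[X in is_diff _ _ X]add0r; apply: is_diffD.
pose h : R -> R := f \o l.
have dh (t : R^o) : 0 <= t <= 1 -> differentiable (f \o l) t.
  by move=> t01; apply: differentiable_comp => //; exact: df.
have Dh (t : R^o) : 0 <= t <= 1 -> is_derive t 1 h ('d f (a + t *: w) w).
  move=> t01; apply: DeriveDef; first exact/derivable1_diffP/dh.
  rewrite deriveE; last exact: dh.
  rewrite diff_comp; [|exact: ex_diff|exact: df].
  by case: (dl t) => _ /= ->; rewrite scale1r.
have [t||t t01] := @MVT_segment R h (fun t => 'd f (a + t *: w) w) 0 1 ler01.
- by rewrite in_itv /= => /andP[/ltW t0 /ltW t1]; apply: Dh; rewrite t0.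
- apply: derivable_within_continuous => t; rewrite in_itv/= => t01.
  by have [] := Dh _ t01.
rewrite subr0 mulr1 /h /l/= scale1r scale0r addr0 -subr_ge0 => ->.
exact: dfge0.
Qed.

Lemma smooth_on_differentiable (R : realType) (E F : normedModType R)
    (U : set E) (f : E -> F) x :
  smooth_on U f -> U x -> differentiable f x.
Proof. by move=> /(_ 1%N)[+ _]; exact. Qed.

Section charts.
Context (R : realType) (E : normedModType R) (M : charted_space E).

Lemma near_chart_dom (c : chart E M) x :
  chart_dom c x -> \near x, chart_dom c x.
Proof.
by move=> cx; apply: open_nbhs_nbhs; split=> //; exact: chart_dom_open.
Qed.

Lemma near_chart_cod (c : chart E M) y :
  chart_cod c y -> \near y, chart_cod c y.
Proof.
by move=> cy; apply: open_nbhs_nbhs; split=> //; exact: chart_cod_open.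
Qed.

(** The change of charts from [chart_at x] to itself is the identity near the point, hence so is its
    differential. This takes a vector at [x] to the coordinates in which openness of a cone is
    tested. *)
Lemma tangent_of_chart_at (x : M) (v : E) :
  smooth_manifold M ->
  tangent_of_chart (chart_at x) (chart_fun (chart_at x) x, v) =
  TangentVector x v.
Proof.
move=> [_ _ Msmooth].
rewrite /tangent_of_chart/= chart_funK; last exact: chart_at_dom.
congr TangentVector.
set c := chart_at x.
have cx : chart_cod c (chart_fun c x) by apply/chart_funS/chart_at_dom.
rewrite (@near_eq_diff _ _ _ _ id) ?diff_val//.
  apply: smooth_on_differentiable (Msmooth c c _ _) _;
    [exact: chart_at_atlas|exact: chart_at_atlas|].
  by split=> //=; exact: chart_invS.
near=> y; rewrite /= chart_invK//.
by near: y; exact: near_chart_cod.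
Unshelve. all: by end_near. Qed.

End charts.

Section real_line.
Context (R : realType).

(** The vectors with negative coordinate form an open set disjoint from the cone. *)
Lemma closure_real_line_cone :
  closure (@real_line_cone R) `<=` [set p | 0 <= (tvec p : R)].
Proof.
pose N : set (tangent_bundle (real_line R)) := [set p | (tvec p : R) < 0].
have oN : open N.
  (* The only chart is the identity, so its tangent coordinates are the vectors themselves. *)
  move=> c -> /=.
  rewrite [X in open X](_ : _ = setT `*` [set v : R^o | v < 0]).
    apply: open_setX; first exact: openT.
    exact: open_lt.
  apply/seteqP; split=> -[y v] /=; rewrite /N/= diff_val.
    by case.
  by case.
move=> p clp /=; rewrite leNgt; apply/negP => p0.
have [r [/= r0]] := clp N (open_nbhs_nbhs (conj oN p0)).
by move=> /(lt_trans r0); rewrite ltxx.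
Qed.

End real_line.

Section causal.
Context (R : realType) (E : normedModType R) (M : charted_space E).
Variables (g : set (tangent_bundle M)) (q : M -> real_line R).
Hypothesis Mg : causal_manifold g.
Hypothesis gq : causal_morphism g (@real_line_cone R) q.

Lemma chart_differentiable (c : chart E M) y :
  atlas c -> chart_cod c y -> differentiable (q \o chart_inv c : E -> R^o) y.
Proof.
move=> cM cy; have [[_ /(_ c (id_chart R) cM erefl) sq] _] := gq.
exact: smooth_on_differentiable sq _.
Qed.

(** The morphism condition speaks of the preferred chart at the base point, which varies with that
    point. The chain rule carries it over to a fixed chart [c], as is needed along a segment. *)
Lemma causal_morphism_diff_ge0 (c : chart E M) y u :
  atlas c -> chart_cod c y -> g (tangent_of_chart c (y, u)) ->
  0 <= 'd (q \o chart_inv c : E -> R^o) y u.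
Proof.
move=> cM cy gyu.
have [[[_ _ Msmooth] _ _] _] := Mg.
have := gq.2 _ (ex_intro2 _ _ _ (@subset_closure _ g _ gyu) erefl).
move=> /closure_real_line_cone/=.
set x := chart_inv c y; set d := chart_at x.
have dx : chart_dom d x := chart_at_dom x.
have dM : atlas d := chart_at_atlas x.
have dtrans : differentiable (chart_fun d \o chart_inv c) y.
  by apply: smooth_on_differentiable (Msmooth c d cM dM) _.
have dq : differentiable (q \o chart_inv d : E -> R^o) (chart_fun d x).
  by apply: chart_differentiable => //; exact: chart_funS.
have -> : 'd (q \o chart_inv c : E -> R^o) y u =
    'd ((q \o chart_inv d : E -> R^o) \o (chart_fun d \o chart_inv c)) y u.
  apply: near_eq_diff.
  - exact: chart_differentiable.
  - exact: differentiable_comp.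
  near=> z; rewrite /= chart_funK//; near: z.
  exact: (chart_inv_continuous cy) (near_chart_dom dx).
by rewrite diff_comp.
Unshelve. all: by end_near. Qed.

Lemma near_whitney_le (x : M) (v : E) (x_ y_ : nat -> M) (c_ : nat -> R) :
  g (TangentVector x v) -> (forall n, 0 < c_ n) ->
  x_ @ \oo --> x -> y_ @ \oo --> x ->
  (fun n => c_ n *: (chart_fun (chart_at x) (x_ n) -
                     chart_fun (chart_at x) (y_ n))) @ \oo --> v ->
  \forall n \near \oo, (q (y_ n) : R) <= q (x_ n).
Proof.
move=> gxv c0 xx yx cv.
set c := chart_at x.
have [[Msmooth _ _] [og _ _ _]] := Mg.
have cx : chart_dom c x := chart_at_dom x.
have cM : atlas c := chart_at_atlas x.
have : nbhs (chart_fun c x, v)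
    [set p : E * E | chart_cod c p.1 /\ g (tangent_of_chart c p)].
  apply: open_nbhs_nbhs; split; first exact: og.
  by split=> /=; [exact: chart_funS|rewrite tangent_of_chart_at].
(* A product neighbourhood of the base point and the vector; the ball inside [A] is chosen for its
   convexity. *)
case=> -[/= A B] [/nbhs_ballP[e /= e0 eA] vB] AB.
have nearA (z_ : nat -> M) : z_ @ \oo --> x ->
    \forall n \near \oo, ball (chart_fun c x) e (chart_fun c (z_ n)).
  move=> zx; apply: (cvg_comp _ _ zx (chart_fun_continuous cx)).
  exact: nbhsx_ballx.
near=> n.
have xA : ball (chart_fun c x) e (chart_fun c (x_ n)).
  by near: n; exact: nearA.
have yA : ball (chart_fun c x) e (chart_fun c (y_ n)).
  by near: n; exact: nearA.
have cxn : chart_dom c (x_ n) by near: n; exact: xx (near_chart_dom cx).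
have cyn : chart_dom c (y_ n) by near: n; exact: yx (near_chart_dom cx).
have Bn : B (c_ n *: (chart_fun c (x_ n) - chart_fun c (y_ n))).
  by near: n; exact: cv.
set a := chart_fun c (y_ n) in yA Bn *.
set b := chart_fun c (x_ n) in xA Bn *.
(* The vector to the centre of the ball is a convex combination of those from the two endpoints, so
   its norm is at most the larger norm [m]. *)
have seg (t : R) : 0 <= t <= 1 -> A (a + t *: (b - a)).
  move=> /andP[t0 t1]; apply: eA.
  move: xA yA; rewrite -!ball_normE/= => xA yA.
  have -> : chart_fun c x - (a + t *: (b - a)) =
      (1 - t) *: (chart_fun c x - a) + t *: (chart_fun c x - b).
    have -> : b - a = (chart_fun c x - a) - (chart_fun c x - b).
      by rewrite opprB [RHS]addrC addrA subrK.
    by rewrite opprD addrA scalerBr scalerBl scale1r opprB addrA addrAC.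
  rewrite (le_lt_trans (ler_normD _ _))// !normrZ (ger0_norm t0).
  rewrite (@ger0_norm _ (1 - t)) ?subr_ge0//.
  set m := Num.max `|chart_fun c x - a| `|chart_fun c x - b|.
  apply: (@le_lt_trans _ _ m); last by rewrite gt_max xA yA.
  rewrite -[leRHS]mul1r -[X in _ <= X * _](subrK t 1) [leRHS]mulrDl lerD//.
    by rewrite ler_wpM2l ?subr_ge0// le_max lexx.
  by rewrite ler_wpM2l// le_max lexx orbT.
(* Only the rescaled vector is known to be close to [v]; by linearity of the differential the
   positive factor [c_ n] is removed at the end. *)
have segAB (t : R) : 0 <= t <= 1 ->
    chart_cod c (a + t *: (b - a)) /\
    g (tangent_of_chart c (a + t *: (b - a), c_ n *: (b - a))).
  by move=> t01; apply: (AB (_, _)); split=> //=; exact: seg.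
have := @diff_ge0_le_segment R E (q \o chart_inv c) a (b - a).
rewrite subrKC /= !chart_funK//; apply => t /segAB[ct gt].
  exact: chart_differentiable.
have := causal_morphism_diff_ge0 cM ct gt.
by rewrite linearZ/= pmulr_rge0.
Unshelve. all: by end_near. Qed.

Definition time_preorder : preorder M :=
  @Preorder M (fun x y => (q x : R) <= q y) (fun x => lexx (q x : R))
    (fun y x z => @le_trans _ R (q y) (q x) (q z)).

Lemma closed_time_preorder : closed_preorder time_preorder.
Proof.
have [[cq _] _] := gq.
rewrite /closed_preorder.
rewrite (_ : graph _ =
  (fun p : M * M => (q p.2 : R^o) - q p.1) @^-1` [set r | 0 <= r]).
  apply: preimage_closed; last exact: closed_ge.
  move=> p _; apply: (@continuousB R R^o).
    by apply: continuous_comp; [exact: cvg_snd|exact: cq].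
  by apply: continuous_comp; [exact: cvg_fst|exact: cq].
by apply/seteqP; split=> p/=; rewrite /graph/= subr_ge0.
Qed.

(** For large n the pairs [p_ n] outside the graph and [p'_ n] in it would satisfy [q (p_ n).1 <= q
    (p'_ n).1 <= q (p'_ n).2 <= q (p_ n).2], which puts [p_ n] in the graph. *)
Lemma causal_time_preorder : causal_preorder g time_preorder.
Proof.
move=> [[x y] [v w]] [/= gxv gyw] [p_ [p'_ [c_ [[np pp' c0]]]]] /= [px p'x cvw].
have fstC (T U : topologicalType) (u : nat -> T * U) (l : T * U) :
    u @ \oo --> l -> (fun n => (u n).1) @ \oo --> l.1.
  by move=> ul; apply: (cvg_comp u fst ul); exact: cvg_fst.
have sndC (T U : topologicalType) (u : nat -> T * U) (l : T * U) :
    u @ \oo --> l -> (fun n => (u n).2) @ \oo --> l.2.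
  by move=> ul; apply: (cvg_comp u snd ul); exact: cvg_snd.
have qy : \forall n \near \oo, (q (p'_ n).2 : R) <= q (p_ n).2.
  exact: near_whitney_le gyw c0 (sndC _ _ _ _ px) (sndC _ _ _ _ p'x)
                         (sndC _ _ _ _ cvw).
have qx : \forall n \near \oo, (q (p_ n).1 : R) <= q (p'_ n).1.
  (* The antipodal cone puts [- v] in [g], so the two sequences exchange roles. *)
  apply: near_whitney_le gxv c0 (fstC _ _ _ _ p'x) (fstC _ _ _ _ px) _.
  under eq_fun do rewrite -opprB scalerN.
  apply: cvgN; exact: (fstC _ _ _ _ cvw).
have [n [qyn qxn]] : exists n,
    (q (p'_ n).2 : R) <= q (p_ n).2 /\ (q (p_ n).1 : R) <= q (p'_ n).1.
  by near \oo => n; exists n; split; near: n.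
apply: (np n); apply: le_trans qxn (le_trans _ qyn).
exact: (pp' n).
Unshelve. all: by end_near. Qed.

Lemma cc_preorder_time_le x y : cc_preorder g x y -> (q x : R) <= q y.
Proof.
by move=> /(_ time_preorder closed_time_preorder causal_time_preorder).
Qed.

End causal.

Theorem proposition1p53 (R : realType) (n : nat)
  (M : charted_space 'rV[R]_n) (g : set (tangent_bundle M))
  (Mg : causal_manifold g)
  (Mq : exists q : M -> real_line R, cauchy_time_function g q) :
  proper_preorder (cc_preorder g).
Proof.
case: Mq => q [gq _ qproper] A B cA cB.
have [[hM _ _] _ _] := Mg.1.
have cq : continuous (q : M -> R^o) := gq.1.1.
have bnd (K : set M) :
    compact K -> exists r : R, forall x, K x -> `|q x : R| <= r.
  move=> cK.
  have /compact_bounded[r [_ rK]] : compact ((q : M -> R^o) @` K).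
    by apply: continuous_compact => //; exact: continuous_subspaceT.
  (* [compact_bounded] gives a bound by every number strictly above [r]. *)
  by exists (r + 1) => x Kx; apply: (rK (r + 1)); rewrite ?ltrDl//; exists x.
have [a qA] := bnd A cA; have [b qB] := bnd B cB.
have cI : compact (`[- a, b]%classic : set R^o) by exact: segment_compact.
have cJA := (qproper A cA).1 _ cI; have cJB := (qproper B cB).2 _ cI.
have -> : future (cc_preorder g) A `&` past (cc_preorder g) B =
    (future (cc_preorder g) A `&` q @^-1` `[- a, b]) `&`
    (past (cc_preorder g) B `&` q @^-1` `[- a, b]).
  (* The two interval conditions merge into one, which every point between [A] and [B] satisfies by
     monotonicity of [q]. *)
  rewrite setIACA setIid; apply/esym/setIidl => x [[y Ay yx] [z Bz xz]].
  rewrite /= in_itv/=; apply/andP; split.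
    rewrite (le_trans _ (cc_preorder_time_le Mg gq yx))//.
    by have := qA y Ay; rewrite ler_norml => /andP[].
  rewrite (le_trans (cc_preorder_time_le Mg gq xz))//.
  by have := qB z Bz; rewrite ler_norml => /andP[].
(* Since [M] is Hausdorff, the second compact set is closed. *)
by apply: compact_closedI => //; exact: compact_closed.
Qed.
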